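(* Let $f:\mathbb{R}^N\to\mathbb{R}$ be $\mu$-strongly convex and $L_f$-smooth. Let $L_\psi>0$ and let $\phi:\mathbb{R}^N\to\mathbb{R}\cup\{+\infty\}$ be proper, lower semicontinuous and $\rho$-weakly convex with $\rho=1-\frac1{L_\psi}$ and with prox-bound $\lambda_\phi>1$. Let $(g_k)_{k\in\mathbb{N}}$ be a sequence of maps $\mathbb{R}^N\to\mathbb{R}^N$ such that each $g_k$ is an $\epsilon_k$-approximation of $\mathrm{prox}_\phi$ with quality $\sigma$ and is $(L_g,\gamma_k)$-Lipschitz. Let $\tau>0$, let $L_{GM}$ be the Lipschitz constant of $\mathrm{Id}-\tau\nabla f$, and suppose $$L_{FB}:=L_g\,L_{GM}<1 .$$ Let $x^*$ denote the unique minimizer of $f+\phi/\tau$. Then the sequence $(x_k)_{k\in\mathbb{N}}$ generated by $x_0\in\mathbb{R}^N$ and $x_{k+1}=g_k(x_k-\tau\nabla f(x_k))$ converges to 1. a ball of radius $\frac{\gamma+\sigma(\epsilon)}{1-L_{FB}}$ around the minimizer $x^*$ of $f+\phi/\tau$, if $\gamma_k\le\gamma$ and $\epsilon_k\le\epsilon$ for all $k$; 2. the minimizer $x^*$ of $f+\phi/\tau$, if $\lim_{k\to+\infty}\gamma_k+\sigma(\epsilon_k)=0$.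
   Context: $\phi$ is $\rho$-weakly convex if $\phi+\frac{\rho}{2}\|\cdot\|^2$ is convex. The prox-bound $\lambda_\phi$ is the supremum of all $\lambda>0$ such that $\inf_{x}\{\phi(x)+\frac1{2\lambda}\|x-y\|^2\}>-\infty$ for some $y$. $L_f$-smooth means differentiable with $L_f$-Lipschitz gradient. $\mathrm{prox}_\phi(y)=\operatorname{argmin}_{x\in\mathbb{R}^N}\{\phi(x)+\frac12\|x-y\|^2\}$. ''Quality $\sigma$'': $\sigma:\mathbb{R}^+\to\mathbb{R}^+$ is a nondecreasing function such that $\|\mathrm{prox}_\phi(x)-g_k(x)\|\le\sigma(\epsilon_k)$ for all $x\in\mathbb{R}^N$ and all $k$. A map $g$ is $(L_g,\gamma)$-Lipschitz, with $L_g>0$, $\gamma\ge0$, if $\|g(x)-g(y)\|\le L_g\|x-y\|+\gamma$ for all $x,y\in\mathbb{R}^N$. $(x_k)$ ''converges to a ball of radius $R$ around $x^*$'' means $\limsup_{k\to\infty}\|x_k-x^*\|\le R$. *)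

(* Defs.v *)
From HB Require Import structures.
From mathcomp Require Import all_boot all_order all_algebra.
From mathcomp Require Import all_classical all_reals all_analysis.

Set Implicit Arguments.
Unset Strict Implicit.
Unset Printing Implicit Defensive.

Import Order.TTheory GRing.Theory Num.Theory.
Import numFieldNormedType.Exports.

Local Open Scope classical_set_scope.
Local Open Scope ring_scope.

(* R^N is ['rV[R]_N] for [R : realType].
   Its library norm [`|x|] is the sup norm, so every metric
   notion below is stated with the Euclidean norm [enorm]; only topological
   notions (limits, differentiability, lower semicontinuity), for which the two
   norms agree, are taken from the library. *)

Section definitions.
Context {R : realType} {N : nat}.
Implicit Types (f : 'rV[R]_N -> R) (F phi : 'rV[R]_N -> \bar R).
Implicit Types (h : 'rV[R]_N -> 'rV[R]_N).

Definition enorm (x : 'rV[R]_N) : R := Num.sqrt (\sum_i x 0 i ^+ 2).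

Definition gradient f (x : 'rV[R]_N) : 'rV[R]_N :=
  \row_i 'D_(delta_mx 0 i) f x.

Definition strongly_convex (mu : R) f : Prop :=
  0 < mu /\ convex_function setT (fun x => f x - mu / 2 * enorm x ^+ 2).

Definition lipschitz_with (L : R) h : Prop :=
  forall x y, enorm (h x - h y) <= L * enorm (x - y).

Definition smooth (L : R) f : Prop :=
  (forall x, differentiable f x) /\ lipschitz_with L (gradient f).

(* The smallest Lipschitz constant; [inf] is the library's infimum of a set of
   reals, so this is meaningful for Lipschitz maps only. *)
Definition lipschitz_constant h : R :=
  inf [set L | 0 <= L /\ lipschitz_with L h].

Definition gamma_lipschitz (L gamma : R) h : Prop :=
  [/\ 0 < L, 0 <= gamma &
      forall x y, enorm (h x - h y) <= L * enorm (x - y) + gamma].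

Definition proper_fun F : Prop :=
  (forall x, F x != -oo%E) /\ (exists x, F x != +oo%E).

(* Intended for functions that never take the value -oo; the right-hand side
   uses the library convention 0 * +oo = 0. *)
Definition econvex F : Prop :=
  forall (x y : 'rV[R]_N) (t : R), 0 <= t <= 1 ->
    (F (t *: x + (1 - t) *: y)%R <= t%:E * F x + (1 - t)%:E * F y)%E.

Definition weakly_convex (rho : R) phi : Prop :=
  econvex (fun x => phi x + (rho / 2 * enorm x ^+ 2)%:E)%E.

Definition prox_bound phi : \bar R :=
  ereal_sup [set lambda%:E | lambda in [set lambda : R | 0 < lambda /\
    exists y, (-oo < ereal_inf
      (range (fun x => phi x + ((2 * lambda)^-1 * enorm (x - y) ^+ 2)%:E)))%E]].

Definition argmin F : set 'rV[R]_N := [set x | forall z, (F x <= F z)%E].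

(* [xget 0] picks the element of the argmin, which is a singleton whenever
   [phi] is proper, lower semicontinuous and rho-weakly convex with rho < 1. *)
Definition prox phi (y : 'rV[R]_N) : 'rV[R]_N :=
  xget 0 (argmin (fun x => phi x + (2^-1 * enorm (x - y) ^+ 2)%:E)%E).

(* sigma maps [0, +oo[ to [0, +oo[ and is nondecreasing there; its values at
   negative arguments are irrelevant. *)
Definition quality_function (sigma : R -> R) : Prop :=
  (forall e, 0 <= e -> 0 <= sigma e) /\
  (forall e e', 0 <= e -> e <= e' -> sigma e <= sigma e').

Definition prox_approximation (sigma : R -> R) phi (epsilon : R) h : Prop :=
  0 <= epsilon /\ forall x, enorm (prox phi x - h x) <= sigma epsilon.

Definition converges_to_ball (x : nat -> 'rV[R]_N) (r : R) (c : 'rV[R]_N) : Prop :=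
  (limn_esup (fun k => (enorm (x k - c))%:E) <= r%:E)%E.

End definitions.

(* Main.v *)
Require Import Defs.
From HB Require Import structures.
From mathcomp Require Import all_boot all_order all_algebra.
From mathcomp Require Import all_classical all_reals all_analysis.
From mathcomp Require Import ring lra.

Set Implicit Arguments.
Unset Strict Implicit.
Unset Printing Implicit Defensive.

Import Order.TTheory GRing.Theory Num.Theory.
Import numFieldNormedType.Exports.

Local Open Scope classical_set_scope.
Local Open Scope ring_scope.

(** Write [T x = x - tau *: gradient f x].  The proof is the usual analysis of
    a contraction whose iteration is perturbed at each step.

    The one fact that involves the variational structure is that the minimizer
    [xs] of [f + phi / tau] is a fixed point of the exact forward-backward map,
    [prox phi (T xs) = xs] ([prox_gradient_step]).  Comparing [xs] with the
    points of the segment from [xs] to [z], bounding [phi] on this segment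
    by weak convexity, dividing by the length parameter and letting it tend to
    zero gives the first-order inequality
    [composite_variational_inequality].  Completing the square turns it into
    quadratic growth, with modulus [(1 - rho) / 2 > 0], of the function
    minimized by the proximal map at [T xs], so that [xs] is its only
    minimizer.

    Then [g (T x) - xs] splits into [g (T x) - g (T xs)], which the approximate
    Lipschitz property of [g] controls, and [g (T xs) - prox phi (T xs)], which
    the quality of the approximation controls ([approximate_step]).  The
    distances [a k] from the iterates to [xs] therefore satisfy
    [a k.+1 <= L_FB * a k + (gamma_ k + sigma (eps_ k))] with [0 <= L_FB < 1].
    If the error term is eventually at most [B], then [a k] is eventually below
    [B / (1 - L_FB) + e] for every [e > 0] ([perturbed_contraction_near]).
    The first claim takes for [B] the uniform bound on the errors, the second
    an arbitrarily small [B]. *)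

(** * Euclidean geometry of row vectors *)

Section euclidean.
Context {R : realType} {N : nat}.
Implicit Types u v w : 'rV[R]_N.

Definition dot u v : R := \sum_i u 0 i * v 0 i.

Lemma enorm_ge0 u : 0 <= enorm u.
Proof. exact: sqrtr_ge0. Qed.

Lemma enorm_sqr u : enorm u ^+ 2 = dot u u.
Proof.
rewrite sqr_sqrtr; last by apply: sumr_ge0 => i _; exact: sqr_ge0.
by apply: eq_bigr => i _; rewrite expr2.
Qed.

Lemma coord_le_enorm u i : `|u 0 i| <= enorm u.
Proof.
rewrite -sqrtr_sqr ler_wsqrtr// (bigD1 i)//= lerDl.
by apply: sumr_ge0 => j _; exact: sqr_ge0.
Qed.

Lemma enorm_eq0 u : enorm u = 0 -> u = 0.
Proof.
move=> u0; apply/rowP => i; rewrite mxE; apply: normr0_eq0; apply/eqP.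
by rewrite eq_le normr_ge0 andbT -u0 coord_le_enorm.
Qed.

Lemma enorm_opp u : enorm (- u) = enorm u.
Proof.
by rewrite /enorm; congr Num.sqrt; apply: eq_bigr => i _; rewrite mxE sqrrN.
Qed.

Lemma enorm_distC u v : enorm (u - v) = enorm (v - u).
Proof. by rewrite -opprB enorm_opp. Qed.

Lemma enorm_scale (a : R) u : enorm (a *: u) = `|a| * enorm u.
Proof.
apply/eqP; rewrite -(@eqrXn2 _ 2)// ?mulr_ge0 ?enorm_ge0//.
rewrite exprMn !enorm_sqr real_normK ?num_real// mulr_sumr; apply/eqP.
by apply: eq_bigr => i _; rewrite !mxE; ring.
Qed.

Lemma enormD_sqr u v : enorm (u + v) ^+ 2 = enorm u ^+ 2 + dot u v *+ 2 + enorm v ^+ 2.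
Proof.
rewrite !enorm_sqr -sumrMnl -!big_split/=; apply: eq_bigr => i _.
by rewrite !mxE; ring.
Qed.

Lemma dotZl (a : R) u v : dot (a *: u) v = a * dot u v.
Proof. by rewrite mulr_sumr; apply: eq_bigr => i _; rewrite mxE mulrA. Qed.

Lemma dotZr (a : R) u v : dot u (a *: v) = a * dot u v.
Proof. by rewrite mulr_sumr; apply: eq_bigr => i _; rewrite mxE mulrCA. Qed.

(** Cauchy-Schwarz, from the nonnegativity of the squared norm of
    [enorm v *: u - enorm u *: v]. *)
Lemma dot_le_enorm u v : dot u v <= enorm u * enorm v.
Proof.
have [u0|u0] := eqVneq (enorm u) 0.
  by rewrite (enorm_eq0 u0) -(scale0r 0) dotZl mul0r mulr_ge0 ?enorm_ge0.
have [v0|v0] := eqVneq (enorm v) 0.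
  by rewrite (enorm_eq0 v0) -(scale0r 0) dotZr mul0r mulr_ge0 ?enorm_ge0.
have uv0 : 0 < enorm u * enorm v by rewrite mulr_gt0// lt0r ?u0 ?v0 enorm_ge0.
have := sqr_ge0 (enorm (enorm v *: u + (- enorm u) *: v)).
rewrite enormD_sqr !enorm_scale normrN !exprMn !real_normK ?num_real//.
rewrite dotZl dotZr => h; rewrite -(ler_pM2l uv0); nra.
Qed.

Lemma enorm_triangle u v : enorm (u + v) <= enorm u + enorm v.
Proof.
rewrite -(@ler_pXn2r _ 2)// ?nnegrE ?addr_ge0 ?enorm_ge0//.
by rewrite enormD_sqr sqrrD lerD2r lerD2l ler_wMn2r// dot_le_enorm.
Qed.

(** The topology of ['rV[R]_N] is that of the sup norm; this comparison turns
    Euclidean estimates into convergence. *)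
Lemma mx_norm_le_enorm u : `|u| <= enorm u.
Proof.
rewrite [`|u|]mx_normrE; apply/bigmax_leP; split; first exact: enorm_ge0.
by move=> [i j] _ /=; rewrite ord1 coord_le_enorm.
Qed.

(** The defect of convexity of the squared norm is exactly quadratic; it is what
    a weakly convex function loses along a segment. *)
Lemma enorm_convex_sqr (t : R) u v :
  enorm (t *: u + (1 - t) *: v) ^+ 2 =
  t * enorm u ^+ 2 + (1 - t) * enorm v ^+ 2 - t * (1 - t) * enorm (u - v) ^+ 2.
Proof.
rewrite !enorm_sqr !mulr_sumr -big_split/=.
by rewrite -sumrB; apply: eq_bigr => i _; rewrite !mxE; ring.
Qed.

End euclidean.

(** * The gradient step *)

Section gradient_step.
Context {R : realType} {N : nat}.
Implicit Types (f : 'rV[R]_N -> R) (h : 'rV[R]_N -> 'rV[R]_N).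

Lemma derive_gradient f (x v : 'rV[R]_N) :
  differentiable f x -> 'D_v f x = dot (gradient f x) v.
Proof.
move=> df; rewrite deriveE// [in LHS](row_sum_delta v) linear_sum.
by apply: eq_bigr => i _; rewrite linearZ mxE deriveE// -[LHS]/(_ * _) mulrC.
Qed.

(** The infimum of the Lipschitz constants is attained, because for each pair of
    points a Lipschitz bound is a closed condition on the constant. *)
Lemma lipschitz_constantP (L : R) h : lipschitz_with L h ->
  0 <= lipschitz_constant h /\ lipschitz_with (lipschitz_constant h) h.
Proof.
move=> hL.
have Lne : [set L | 0 <= L /\ lipschitz_with L h] !=set0.
  exists `|L|; split=> // x y; apply: le_trans (hL x y) _.
  by rewrite ler_wpM2r ?enorm_ge0// ler_norm.
split; first by apply: lb_le_inf => // K [].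
move=> x y; have [xy0|xy0] := eqVneq (enorm (x - y)) 0.
  by have := hL x y; rewrite xy0 !mulr0.
have xy_gt0 : 0 < enorm (x - y) by rewrite lt0r xy0 enorm_ge0.
rewrite -ler_pdivrMr//; apply: lb_le_inf => // K [_ hK].
by rewrite ler_pdivrMr.
Qed.

(** Crude, but it shows that the set of Lipschitz constants of the gradient step
    is nonempty, so that its infimum is meaningful. *)
Lemma lipschitz_gradient_step (L tau : R) f : lipschitz_with L (gradient f) ->
  lipschitz_with (1 + `|tau| * L) (fun x => x - tau *: gradient f x).
Proof.
move=> fL x y.
have -> : x - tau *: gradient f x - (y - tau *: gradient f y) =
    (x - y) + (- tau) *: (gradient f x - gradient f y).
  by apply/rowP => i; rewrite !mxE; ring.
apply: le_trans (enorm_triangle _ _) _.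
rewrite enorm_scale normrN mulrDl mul1r lerD2l -mulrA ler_wpM2l//; exact: fL.
Qed.

End gradient_step.

(** * Minimizers are fixed points of the forward-backward map *)

Section fixed_point.
Context {R : realType} {N : nat}.
Implicit Types (f : 'rV[R]_N -> R) (phi : 'rV[R]_N -> \bar R).

Lemma weakly_convex_fin (rho : R) phi (x z : 'rV[R]_N) (p q t : R) :
  weakly_convex rho phi -> phi x = p%:E -> phi z = q%:E -> 0 <= t <= 1 ->
  (phi (t *: z + (1 - t) *: x)%R <=
    (t * q + (1 - t) * p + rho / 2 * (t * (1 - t)) * enorm (z - x) ^+ 2)%:E)%E.
Proof.
move=> wc px qz t01; have := wc z x t t01; rewrite /= px qz enorm_convex_sqr.
case: (phi _) => [r| |] //=; last by move=> _; rewrite leNye.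
rewrite !lee_fin; nra.
Qed.

(** First-order optimality of [xs] for [f + phi / tau], tested in the direction
    [z - xs].  The one-sided limit, as [t] decreases to 0, of
    [q - p + c * (1 - t) + tau * dq t] is the right-hand side, where [dq] is the
    difference quotient of [f]; for [0 < t < 1] this expression is nonnegative
    because [xs] is minimal and [phi] is weakly convex on the segment. *)
Lemma composite_variational_inequality (rho tau : R) f phi
    (xs z : 'rV[R]_N) (p q : R) :
  0 < tau -> differentiable f xs -> weakly_convex rho phi ->
  argmin (fun x => (f x)%:E + (tau^-1)%:E * phi x)%E xs ->
  phi xs = p%:E -> phi z = q%:E ->
  0 <= q - p + rho / 2 * enorm (z - xs) ^+ 2 + tau * dot (gradient f xs) (z - xs).
Proof.
move=> tau0 df wc xmin px qz.
pose c := rho / 2 * enorm (z - xs) ^+ 2.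
pose dq t := t^-1 * (f (t *: (z - xs) + xs) - f xs).
have dqE : dq t @[t --> 0^'+] --> dot (gradient f xs) (z - xs).
  rewrite -derive_gradient//; apply: cvg_dnbhs_at_right.
  exact: (@diff_derivable _ _ _ f xs (z - xs) df).
have t0 : (t : R) @[t --> 0^'+] --> (0 : R).
  by apply: cvg_at_right_filter; exact: cvg_id.
have : q - p + c * (1 - t) + tau * dq t @[t --> 0^'+] -->
    q - p + c * (1 - 0) + tau * dot (gradient f xs) (z - xs).
  apply: cvgD; last by apply: cvgM => //; exact: cvg_cst.
  apply: cvgD; first exact: cvg_cst.
  apply: cvgM; first exact: cvg_cst.
  by apply: cvgB => //; exact: cvg_cst.
rewrite subr0 mulr1 => /cvgr_to_ge; apply.
near=> t.
have tgt0 : 0 < t by near: t; exact: nbhs_right_gt.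
have tlt1 : t < 1 by near: t; exact: nbhs_right_lt.
have t01 : 0 <= t <= 1 by rewrite !ltW.
have xtE : t *: (z - xs) + xs = t *: z + (1 - t) *: xs.
  by apply/rowP => i; rewrite !mxE; ring.
have := weakly_convex_fin wc px qz t01.
have := xmin (t *: z + (1 - t) *: xs); rewrite /= px /dq xtE.
have tv0 : 0 < tau^-1 by rewrite invr_gt0.
case: (phi _) => [r| |] //=; last by rewrite gt0_muleNy// lte_fin.
rewrite !lee_fin => h1 h2.
have h3 : tau * f xs + p <= tau * f (t *: z + (1 - t) *: xs) + r.
  have := h1; rewrite -(ler_pM2l tau0) !mulrDr !mulrA divff ?gt_eqF//.
  by rewrite !mul1r.
have -> : q - p + c * (1 - t) + tau * (t^-1 * (f (t *: z + (1 - t) *: xs) - f xs))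
  = t^-1 * (t * (q - p) + c * (t * (1 - t)) + tau * (f (t *: z + (1 - t) *: xs) - f xs)).
  by field; rewrite gt_eqF.
rewrite mulr_ge0 ?invr_ge0 ?(ltW tgt0)// /c; lra.
Unshelve. all: by end_near. Qed.

Lemma minimizer_fin_num (tau : R) f phi (xs : 'rV[R]_N) :
  0 < tau -> proper_fun phi ->
  argmin (fun x => (f x)%:E + (tau^-1)%:E * phi x)%E xs -> phi xs \is a fin_num.
Proof.
move=> tau0 [phiNy [z phiz]] /(_ z)/=.
have tv0 : (0 < (tau^-1)%:E)%E by rewrite lte_fin invr_gt0.
move: (phiNy z) (phiNy xs) phiz.
case: (phi z) => // q _; case: (phi xs) => // _ _.
by rewrite gt0_muley// addey// leye_eq.
Qed.

(** Since [rho < 1], adding half the squared distance to the point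
    [xs - tau *: gradient f xs] makes [phi] strongly convex, and its linear part
    cancels the gradient term of the variational inequality.  The resulting
    quadratic growth around [xs] gives both minimality and uniqueness, so that
    the choice made in [prox] is forced. *)
Lemma prox_gradient_step (rho tau : R) f phi (xs : 'rV[R]_N) :
  rho < 1 -> 0 < tau -> differentiable f xs ->
  proper_fun phi -> weakly_convex rho phi ->
  argmin (fun x => (f x)%:E + (tau^-1)%:E * phi x)%E xs ->
  prox phi (xs - tau *: gradient f xs) = xs.
Proof.
move=> rho1 tau0 df pphi wc xmin.
have /fineK/esym px := minimizer_fin_num tau0 pphi xmin.
set p := fine _ in px.
set y := xs - tau *: gradient f xs.
have dist z : enorm (z - y) ^+ 2 = enorm (xs - y) ^+ 2 +
    (tau * dot (gradient f xs) (z - xs)) *+ 2 + enorm (z - xs) ^+ 2.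
  have -> : z - y = tau *: gradient f xs + (z - xs).
    by rewrite /y opprB addrCA.
  have -> : xs - y = tau *: gradient f xs by rewrite /y opprB addrCA subrr addr0.
  by rewrite enormD_sqr dotZl.
(* The squared term in [dist] has weight 1/2, of which weak convexity consumes
   the fraction [rho]. *)
have growth z q : phi z = q%:E ->
    p + 2^-1 * enorm (xs - y) ^+ 2 + (1 - rho) / 2 * enorm (z - xs) ^+ 2
      <= q + 2^-1 * enorm (z - y) ^+ 2.
  move=> qz; have := composite_variational_inequality tau0 df wc xmin px qz.
  rewrite (dist z); lra.
apply: xget_unique => [z|z zmin].
  case Ez: (phi z) => [q| |] /=; rewrite px; first last.
  - by case: pphi => /(_ z); rewrite Ez.
  - by rewrite addye// leey.
  rewrite lee_fin; apply: le_trans (growth z q Ez).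
  by rewrite lerDl mulr_ge0 ?sqr_ge0// divr_ge0// subr_ge0 ltW.
have := zmin xs; rewrite /= px.
case Ez: (phi z) => [q| |] //=; last by case: pphi => /(_ z); rewrite Ez.
rewrite lee_fin => /(le_trans (growth z q Ez)).
rewrite gerDl pmulr_rle0 ?divr_gt0 ?subr_gt0// => zxs.
apply/subr0_eq/enorm_eq0/eqP; rewrite -sqrf_eq0.
by rewrite eq_le zxs sqr_ge0.
Qed.

End fixed_point.

(** * Perturbed contractive recursions *)

Section perturbed_contraction.
Context {R : realType}.
Implicit Types (a b : nat -> R).

(** The right-hand side is the exact solution of the recursion with equality:
    the geometric sum of the errors is [B * (1 - q ^+ k) / (1 - q)]. *)
Lemma contraction_iter_bound a (q B : R) : 0 <= q < 1 ->
  (forall k, a k.+1 <= q * a k + B) ->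
  forall k, a k <= q ^+ k * a 0%N + B / (1 - q) * (1 - q ^+ k).
Proof.
move=> /andP[q0 q1] rec; elim=> [|k IH].
  by rewrite expr0 mul1r subrr mulr0 addr0.
apply: le_trans (rec k) _.
apply: le_trans (_ : q * (q ^+ k * a 0%N + B / (1 - q) * (1 - q ^+ k)) + B <= _).
  by rewrite lerD2r ler_wpM2l.
rewrite exprS le_eqVlt; apply/orP; left; apply/eqP; field.
by rewrite subr_eq0 eq_sym lt_eqF.
Qed.

(** Only the tail of the errors matters: restart the recursion at an index from
    which [b] is bounded by [B], and let the geometric term vanish. *)
Lemma perturbed_contraction_near a b (q B : R) : 0 <= q < 1 ->
  (forall k, a k.+1 <= q * a k + b k) -> (\forall k \near \oo, b k <= B) ->
  forall e, 0 < e -> \forall k \near \oo, a k <= B / (1 - q) + e.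
Proof.
move=> /[dup] q01 /andP[q0 q1] rec [n _ bB] e e0.
have bnd : forall k, a (k + n)%N <= q ^+ k * a n + B / (1 - q) * (1 - q ^+ k).
  apply: (contraction_iter_bound (a := fun k => a (k + n)%N)) => // k.
  by rewrite addSn; apply: le_trans (rec _) _; rewrite lerD2l bB//= leq_addl.
have lim : q ^+ k * a n + B / (1 - q) * (1 - q ^+ k) @[k --> \oo] -->
    0 * a n + B / (1 - q) * (1 - 0).
  have qk : q ^+ k @[k --> \oo] --> 0 by apply: cvg_expr; rewrite ger0_norm.
  apply: cvgD; first by apply: cvgM => //; exact: cvg_cst.
  apply: cvgM; first exact: cvg_cst.
  by apply: cvgB => //; exact: cvg_cst.
rewrite mul0r add0r subr0 mulr1 in lim.
have /(cvgr_le _ lim) [m _ mP] : B / (1 - q) < B / (1 - q) + e by rewrite ltrDl.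
exists (m + n)%N => // k /= mnk.
have nk : (n <= k)%N by apply: leq_trans mnk; rewrite leq_addl.
rewrite -(subnK nk); apply: le_trans (bnd _) (mP _ _) => /=.
by rewrite leq_subRL// addnC.
Qed.

Lemma limn_esup_le (u : nat -> R) (r : R) :
  (forall e, 0 < e -> \forall k \near \oo, u k <= r + e) ->
  (limn_esup (fun k => (u k)%:E) <= r%:E)%E.
Proof.
move=> ur; apply/lee_addgt0Pr => e e0.
rewrite /limn_esup limf_esupE; apply: ge_ereal_inf.
exists (ereal_sup ((fun k => (u k)%:E) @` [set k | u k <= r + e])).
  by exists [set k | u k <= r + e] => //; exact: ur.
by apply: ge_ereal_sup => _ [k /= uk <-]; rewrite lee_fin.
Qed.

End perturbed_contraction.

(** * The approximate forward-backward iteration *)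

Section approximate_fixed_point.
Context {R : realType} {N : nat}.
Implicit Types (phi : 'rV[R]_N -> \bar R).

(** The perturbations of size [gamma] and [sigma eps] enter only at the fixed
    point [xs] of the exact map, so they add up without being multiplied by a
    Lipschitz constant. *)
Lemma approximate_step (sigma : R -> R) phi (eps gamma L_g L_T : R)
    (g T : 'rV[R]_N -> 'rV[R]_N) (xs : 'rV[R]_N) :
  prox_approximation sigma phi eps g -> gamma_lipschitz L_g gamma g ->
  lipschitz_with L_T T -> prox phi (T xs) = xs ->
  forall x, enorm (g (T x) - xs) <=
    L_g * L_T * enorm (x - xs) + (gamma + sigma eps).
Proof.
move=> [_ gprox] [Lg0 _ glip] TL fix_xs x.
have -> : g (T x) - xs = (g (T x) - g (T xs)) + (g (T xs) - xs).
  by rewrite addrA subrK.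
apply: le_trans (enorm_triangle _ _) _; rewrite addrA lerD//; last first.
  by rewrite enorm_distC -{1}fix_xs gprox.
apply: le_trans (glip _ _) _; rewrite lerD2r -mulrA ler_wpM2l ?(ltW Lg0)//.
Qed.

End approximate_fixed_point.
Theorem proposition29 (R : realType) (N : nat)
  (f : 'rV[R]_N -> R) (mu L_f : R)
  (f_convex : strongly_convex mu f)
  (f_smooth : smooth L_f f)
  (phi : 'rV[R]_N -> \bar R) (L_psi : R)
  (L_psi_gt0 : 0 < L_psi)
  (phi_proper : proper_fun phi)
  (phi_lsc : lower_semicontinuous phi)
  (phi_weakly_convex : weakly_convex (1 - 1 / L_psi) phi)
  (phi_prox_bound : (1%:E < prox_bound phi)%E)
  (sigma : R -> R)
  (sigma_quality : quality_function sigma)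
  (g : nat -> 'rV[R]_N -> 'rV[R]_N) (eps_ gamma_ : nat -> R) (L_g : R)
  (g_approx : forall k, prox_approximation sigma phi (eps_ k) (g k))
  (g_lipschitz : forall k, gamma_lipschitz L_g (gamma_ k) (g k))
  (tau : R) (tau_gt0 : 0 < tau)
  (L_GM L_FB : R)
  (L_GM_def : L_GM = lipschitz_constant (fun x => x - tau *: gradient f x))
  (L_FB_def : L_FB = L_g * L_GM)
  (L_FB_lt1 : L_FB < 1)
  (xstar : 'rV[R]_N)
  (xstar_unique_minimizer :
    argmin (fun x => (f x)%:E + (tau^-1)%:E * phi x)%E = [set xstar])
  (x : nat -> 'rV[R]_N)
  (x_rec : forall k, x k.+1 = g k (x k - tau *: gradient f (x k))) :
  (forall gamma eps : R,
     (forall k, gamma_ k <= gamma) -> (forall k, eps_ k <= eps) ->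
     converges_to_ball x ((gamma + sigma eps) / (1 - L_FB)) xstar) /\
  ((fun k => gamma_ k + sigma (eps_ k)) @ \oo --> 0 ->
     x @ \oo --> xstar).
Proof.
move: f_smooth => [f_diff grad_lip].
have [L_GM_ge0 L_GM_lip] :=
  lipschitz_constantP (lipschitz_gradient_step tau grad_lip).
rewrite -L_GM_def in L_GM_ge0 L_GM_lip.
have L_FB01 : 0 <= L_FB < 1.
  rewrite L_FB_lt1 L_FB_def mulr_ge0// ltW//.
  by case: (g_lipschitz 0%N).
have xs_min : argmin (fun x => (f x)%:E + (tau^-1)%:E * phi x)%E xstar.
  by rewrite xstar_unique_minimizer.
have rho_lt1 : 1 - 1 / L_psi < 1 by rewrite gtrBl divr_gt0.
have xs_fix := prox_gradient_step rho_lt1 tau_gt0 (f_diff xstar) phi_proper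
  phi_weakly_convex xs_min.
have dist_rec k : enorm (x k.+1 - xstar) <=
    L_FB * enorm (x k - xstar) + (gamma_ k + sigma (eps_ k)).
  rewrite x_rec L_FB_def.
  exact: (approximate_step (g_approx k) (g_lipschitz k) L_GM_lip xs_fix).
split=> [gamma eps gammaP epsP|err0].
  apply: limn_esup_le; apply: perturbed_contraction_near L_FB01 dist_rec _.
  apply: nearW => k; apply: lerD (gammaP k) _.
  by case: sigma_quality => _; apply=> //; case: (g_approx k).
apply/cvgrPdist_le => e e0.
(* The bound on the errors for which [perturbed_contraction_near] yields
   [e / 2 + e / 2]. *)
have B0 : 0 < (1 - L_FB) * (e / 2) by rewrite mulr_gt0 ?subr_gt0 ?divr_gt0.
have : \forall k \near \oo, gamma_ k + sigma (eps_ k) <= (1 - L_FB) * (e / 2).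
  exact: (cvgr_le _ err0).
move=> /(perturbed_contraction_near L_FB01 dist_rec) /(_ (e / 2)).
rewrite divr_gt0// => /(_ isT); apply: filterS => k.
rewrite mulrAC divff ?mul1r; last by rewrite subr_eq0 eq_sym lt_eqF.
rewrite -splitr; apply: le_trans.
by rewrite distrC mx_norm_le_enorm.
Qed.
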